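(* Let $M$ be a positive mixed graph and $M_U$ its underlying graph (viewed as a mixed graph with all edges undirected). Then the spectrum of $R_H(M)$ equals the spectrum of $R_H(M_U)$.
   Context: A mixed graph $M$ is obtained from a simple graph $M_U$ by orienting some of its edges; degrees $d_k$ are taken in $M_U$. The Hermitian-Randić matrix $R_H(M)$ has $(k,l)$ entry $\frac{1}{\sqrt{d_kd_l}}$ if $v_kv_l$ is an undirected edge, $\frac{\mathrm{i}}{\sqrt{d_kd_l}}$ if $(v_k,v_l)$ is an arc, $\frac{-\mathrm{i}}{\sqrt{d_kd_l}}$ if $(v_l,v_k)$ is an arc, and $0$ otherwise. For a mixed cycle $C=v_1\cdots v_lv_1$ (cycle of $M_U$ of length $\ge3$ traversed in a direction) its value is $(r_h)_{12}(r_h)_{23}\cdots(r_h)_{l1}$; $C$ is positive if its value equals $\prod_{v_j\in V(C)}\frac{1}{d(v_j)}$. A mixed graph is positive if every mixed cycle in it is positive. *)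

(* Defs.v *)
From HB Require Import structures.
From mathcomp Require Import all_boot all_order all_algebra.
From mathcomp Require Import finmap multiset.

Set Implicit Arguments.
Unset Strict Implicit.
Unset Printing Implicit Defensive.

Import Order.TTheory GRing.Theory Num.Theory.
Local Open Scope ring_scope.

Record simple_graph (n : nat) := SimpleGraph {
  adj : rel 'I_n;
  adj_sym : symmetric adj;
  adj_irr : irreflexive adj
}.

(* [arc M u v] means that the edge uv is oriented from u to v; edges carrying *)
(* no arc in either direction are undirected.                                 *)
Record mixed_graph (n : nat) := MixedGraph {
  underlying : simple_graph n;
  arc : rel 'I_n;
  arc_adj : forall u v, arc u v -> adj underlying u v;
  arc_asym : forall u v, arc u v -> ~~ arc v u
}.

Definition undirected (n : nat) (G : simple_graph n) : mixed_graph n :=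
  @MixedGraph n G (fun _ _ => false)
    (fun u v (h : false) => False_ind _ (notF h))
    (fun u v (h : false) => isT).

Definition edge (n : nat) (M : mixed_graph n) (u v : 'I_n) : bool :=
  [&& adj (underlying M) u v, ~~ arc M u v & ~~ arc M v u].

Definition degree (n : nat) (M : mixed_graph n) (u : 'I_n) : nat :=
  #|[set v | adj (underlying M) u v]|.

(* The field [C] plays the role of the complex numbers, with 'i = sqrt (-1).  *)
Definition hermitian_randic (C : numClosedFieldType) (n : nat)
    (M : mixed_graph n) : 'M[C]_n :=
  \matrix_(k, l)
    let s := sqrtC (degree M k * degree M l)%:R in
    if edge M k l then 1 / s
    else if arc M k l then 'i / s
    else if arc M l k then - 'i / s
    else 0.

(* The sequence [:: v_1; ...; v_l] lists the vertices in order of traversal;  *)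
(* [cycle] includes the closing adjacency between v_l and v_1.                *)
Definition is_mixed_cycle (n : nat) (M : mixed_graph n) (c : seq 'I_n) : bool :=
  [&& 2 < size c, uniq c & cycle (adj (underlying M)) c]%N.

Definition cycle_value (C : numClosedFieldType) (n : nat) (M : mixed_graph n)
    (c : seq 'I_n) : C :=
  \prod_(v <- c) hermitian_randic C M v (next c v).

Definition positive_cycle (C : numClosedFieldType) (n : nat)
    (M : mixed_graph n) (c : seq 'I_n) : Prop :=
  cycle_value C M c = \prod_(v <- c) (1 / (degree M v)%:R).

Definition positive_mixed_graph (C : numClosedFieldType) (n : nat)
    (M : mixed_graph n) : Prop :=
  forall c : seq 'I_n, is_mixed_cycle M c -> positive_cycle C M c.

(* The multiset of eigenvalues, counted with algebraic multiplicity: the      *)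
(* linear factors of the characteristic polynomial.                           *)
Definition spectrum (C : numClosedFieldType) (n : nat) (A : 'M[C]_n) : {mset C}%mset :=
  seq_mset (sval (closed_field_poly_normal (char_poly A))).

Lemma spectrumE (C : numClosedFieldType) (n : nat) (A : 'M[C]_n) :
  char_poly A = \prod_(a <- spectrum A) ('X - a%:P).
Proof.
rewrite /spectrum; case: closed_field_poly_normal => r /= {1}->.
rewrite (monicP (char_poly_monic A)) scale1r.
by apply: perm_big; rewrite perm_sym perm_eq_seq_mset.
Qed.

Lemma mem_spectrum (C : numClosedFieldType) (n : nat) (A : 'M[C]_n) (a : C) :
  (a \in spectrum A) = eigenvalue A a.
Proof.
by rewrite eigenvalue_root_char spectrumE root_prod_XsubC.
Qed.

(* Main.v *)
Require Import Defs.
From mathcomp Require Import all_boot all_order all_algebra.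
From mathcomp Require Import finmap multiset.

(** Factor [R_H(M) u v = gain u v * R_H(M_U) u v], where the gain of an edge is
  1, i or -i.  Positivity says that the gains multiply to 1 along every cycle of
  length at least 3, hence, cutting a closed walk at a repeated vertex, along
  every closed walk.  The gain of an edge uv is therefore of the form
  [s u / s v] for a nowhere zero potential [s], so that [diag s] conjugates
  [R_H(M_U)] to [R_H(M)] and both matrices have the same characteristic
  polynomial. *)

Set Implicit Arguments.
Unset Strict Implicit.
Unset Printing Implicit Defensive.

Import Order.TTheory GRing.Theory Num.Theory.
Local Open Scope ring_scope.

(** Over the polynomial ring, [P] still intertwines the two characteristic matrices. Taking
    determinants and cancelling the nonzero constant [\det P] suffices, so [P] is never inverted. *)
Lemma char_poly_similar (R : idomainType) (n : nat) (P A B : 'M[R]_n) :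
  \det P != 0 -> A *m P = P *m B -> char_poly A = char_poly B.
Proof.
move=> detP AP; pose Q := map_mx (@polyC R) P.
have detQ : \det Q != 0 by rewrite det_map_mx polyC_eq0.
apply: (mulIf detQ); rewrite [RHS]mulrC /char_poly -!det_mulmx; congr (\det _).
by rewrite mulmxBl mulmxBr scalar_mxC -!map_mxM AP.
Qed.

Lemma map_belast_fpath (T : eqType) (f : T -> T) x p :
  fpath f x p -> [seq f v | v <- belast x p] = p.
Proof. by elim: p x => //= y p IHp x /andP[/eqP-> /IHp->]. Qed.

(** Mapping [next] over a duplicate-free list rotates it by one place; this lets products over a
    cycle be reindexed by successors. *)
Lemma perm_map_next (T : eqType) (c : seq T) :
  uniq c -> perm_eq [seq next c v | v <- c] c.
Proof.
case: c => // x q /cycle_next Hc.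
have := map_belast_fpath Hc; rewrite belast_rcons => ->.
by rewrite perm_rcons.
Qed.

Lemma not_uniq_split (T : eqType) (p : seq T) :
  ~~ uniq p -> exists y p1 p2 p3, p = p1 ++ y :: p2 ++ y :: p3.
Proof.
elim: p => //= x p IHp; rewrite negb_and negbK => /orP[|/IHp].
  by case/splitPr=> p2 p3; exists x, [::], p2, p3.
by case=> y [p1 [p2 [p3 ->]]]; exists y, (x :: p1), p2, p3.
Qed.

Section WalkWeight.

Variables (F : fieldType) (T : finType) (e : rel T) (g : T -> T -> F).

Fixpoint walk_weight (x : T) (p : seq T) : F :=
  if p is y :: p' then g x y * walk_weight y p' else 1.

Lemma walk_weight_cat x p q :
  walk_weight x (p ++ q) = walk_weight x p * walk_weight (last x p) q.
Proof. by elim: p x => [|y p IHp] x /=; rewrite ?mul1r // IHp mulrA. Qed.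

Lemma walk_weight_fpath f x p :
  fpath f x p -> walk_weight x p = \prod_(v <- belast x p) g v (f v).
Proof.
elim: p x => [|y p IHp] x /=; first by rewrite big_nil.
by case/andP=> /eqP fx /IHp->; rewrite big_cons fx.
Qed.

Lemma walk_weight_cycle x q : uniq (x :: q) ->
  walk_weight x (rcons q x) = \prod_(v <- x :: q) g v (next (x :: q) v).
Proof. by move/cycle_next/walk_weight_fpath; rewrite belast_rcons. Qed.

Hypothesis e_sym : symmetric e.
Hypothesis e_irr : irreflexive e.
Hypothesis g_inv : forall u v, e u v -> g u v * g v u = 1.
Hypothesis g_cycle : forall c, (2 < size c)%N -> uniq c -> cycle e c ->
  \prod_(v <- c) g v (next c v) = 1.

(** Strong induction on length. The list [p] leaves out the start [x], so a nonempty closed walk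
    meets [x] again as the last entry of [p], and [uniq p] says that no other repetition occurs. *)
Lemma closed_walk_weight x p : path e x p -> last x p = x -> walk_weight x p = 1.
Proof.
have [m] := ubnP (size p); elim: m => // m IHm in x p *.
rewrite ltnS => le_p_m e_p; case: (boolP (uniq p)) => [|/not_uniq_split[y [p1 [p2 [p3 Dp]]]]].
  case/lastP: p e_p {le_p_m} => // q y e_q; rewrite last_rcons => + xy.
  rewrite {}xy rcons_uniq -cons_uniq in e_q * => Uq.
  (* Length 1 would be a loop, length 2 goes along an edge and back, and from length 3 on the walk
     is a genuine cycle. *)
  case: q => [|z [|t q]] in e_q Uq *.
  - by move: e_q; rewrite /= e_irr.
  - by case/andP: e_q => /g_inv + _; rewrite /= mulr1.
  - by rewrite walk_weight_cycle // g_cycle.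
rewrite {p}Dp in le_p_m e_p *; rewrite !last_cat /= last_cat /= => p3x.
move: e_p; rewrite cat_path /= cat_path /=.
case/and5P=> e_p1 e_y e_p2 e_y' e_p3.
(* Excising the closed walk from [y] to [y] leaves two strictly shorter closed walks, and weights
   commute in a field. *)
have -> : walk_weight x (p1 ++ y :: p2 ++ y :: p3)
    = walk_weight x (p1 ++ y :: p3) * walk_weight y (rcons p2 y).
  rewrite -cats1 !walk_weight_cat /= !walk_weight_cat /= mulr1.
  by rewrite -!mulrA; congr (_ * (_ * _)); rewrite mulrA mulrC.
move: le_p_m; rewrite !size_cat /= size_cat /= => le_p_m.
rewrite !IHm ?mulr1 ?last_rcons //.
- rewrite size_rcons; apply: leq_trans le_p_m.
  by apply: leq_trans (leq_addl _ _); rewrite ltnS addnS ltnS leq_addr.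
- by rewrite rcons_path e_p2.
- rewrite size_cat /=; apply: leq_trans le_p_m.
  by rewrite -addnS leq_add2l ltnS leq_addl.
- by rewrite cat_path /= e_p1 e_y.
- by rewrite last_cat.
Qed.

Lemma potential_exists :
  exists2 s : T -> F, forall v, s v != 0 & forall u v, e u v -> s u = g u v * s v.
Proof.
have conn_sym : connect_sym e by apply: sym_connect_sym.
have [q e_q last_q] : exists2 q : T -> seq T,
    forall v, path e v (q v) & forall v, last v (q v) = fingraph.root e v.
  apply: (@fin_all_exists2 _ _ (fun v q => path e v q)
    (fun v q => last v q = fingraph.root e v)) => v.
  by have /connectP[q] := connect_root e v; exists q.
(* The potential at [v] is the weight of a chosen walk from [v] to the root of its component. *)
pose s v := walk_weight v (q v).
(* Any walk from the root to [v], followed by [q v], is closed; hence its weight is inverse to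
   [s v]. *)
have s_root v p : path e (fingraph.root e v) p -> last (fingraph.root e v) p = v ->
    walk_weight (fingraph.root e v) p * s v = 1.
  move=> e_p last_p; rewrite -{2}last_p -{1}last_p.
  have := @closed_walk_weight (fingraph.root e v) (p ++ q v).
  by rewrite walk_weight_cat cat_path last_cat last_p e_p e_q last_q /s => ->.
have root_walk v : exists2 p, path e (fingraph.root e v) p
    & last (fingraph.root e v) p = v.
  have /connectP[p e_p Dv] : connect e (fingraph.root e v) v.
    by rewrite conn_sym connect_root.
  by exists p.
exists s => [v | u v e_uv].
  have [p e_p /(s_root _ _ e_p)] := root_walk v.
  by apply: contra_eqN => /eqP->; rewrite mulr0 eq_sym oner_eq0.
have [p e_p last_p] := root_walk u; have wu := s_root u p e_p last_p.
have root_uv : fingraph.root e v = fingraph.root e u.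
  by apply/esym/eqP; rewrite root_connect // connect1.
have wp_neq0 : walk_weight (fingraph.root e u) p != 0.
  by apply: contra_eq_neq wu => ->; rewrite mul0r eq_sym oner_eq0.
(* Prolonging the walk [p] to [u] by the edge to [v] multiplies its weight by [g u v]; comparing
   with [wu] and cancelling the weight of [p] gives the relation. *)
have := s_root v (rcons p v).
rewrite root_uv rcons_path last_rcons e_p last_p => /(_ e_uv erefl).
rewrite -cats1 walk_weight_cat last_p /= mulr1 -mulrA -[RHS]wu.
by move/(mulfI wp_neq0).
Qed.

End WalkWeight.

Section Gain.

Variables (C : numClosedFieldType) (n : nat) (M : mixed_graph n).

Definition gain (u v : 'I_n) : C :=
  if Defs.arc M u v then 'i else if Defs.arc M v u then - 'i else 1.

Lemma gain_inv u v : gain u v * gain v u = 1.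
Proof.
rewrite /gain; case: ifP => [/arc_asym/negPf-> | _].
  by rewrite mulrN mulCii opprK.
by case: ifP => _; rewrite ?mulr1 // mulNr mulCii opprK.
Qed.

Lemma hermitian_randic_undirected u v :
  hermitian_randic C (undirected (underlying M)) u v =
    if adj (underlying M) u v
    then (sqrtC (degree M u)%:R * sqrtC (degree M v)%:R)^-1 else 0.
Proof.
rewrite mxE /edge /= andbT; case: ifP => // _.
by rewrite div1r natrM sqrtCM ?nnegrE ?ler0n.
Qed.

Lemma hermitian_randic_gain u v :
  hermitian_randic C M u v =
    gain u v * hermitian_randic C (undirected (underlying M)) u v.
Proof.
rewrite hermitian_randic_undirected mxE /edge /gain.
rewrite natrM sqrtCM ?nnegrE ?ler0n //.
case: (boolP (Defs.arc M u v)) => [uv | _].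
  by rewrite (arc_adj uv).
case: (boolP (Defs.arc M v u)) => [vu | _].
  by rewrite adj_sym (arc_adj vu).
by rewrite andbT; case: ifP => _; rewrite mul1r ?div1r.
Qed.

Hypothesis M_pos : positive_mixed_graph C M.

Lemma gain_cycle c : (2 < size c)%N -> uniq c -> cycle (adj (underlying M)) c ->
  \prod_(v <- c) gain v (next c v) = 1.
Proof.
move=> c_gt2 Uc adj_c.
have := M_pos (c := c); rewrite /is_mixed_cycle c_gt2 Uc adj_c => /(_ isT).
rewrite /positive_cycle /cycle_value.
pose d v : C := sqrtC (degree M v)%:R.
have -> : \prod_(v <- c) hermitian_randic C M v (next c v)
    = \prod_(v <- c) gain v (next c v) * \prod_(v <- c) (1 / (degree M v)%:R).
  (* Each vertex contributes its inverse square root of degree twice, once as tail and once as head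
     of a step; [next] permutes the cycle, so these pair up to 1/d. *)
  have -> : \prod_(v <- c) (1 / (degree M v)%:R : C)
      = \prod_(v <- c) (d v)^-1 * \prod_(v <- c) (d (next c v))^-1.
    rewrite -(big_map (next c) xpredT (fun v => (d v)^-1)).
    rewrite (perm_big _ (perm_map_next Uc)) -big_split.
    by apply: eq_bigr => v _; rewrite /= -invfM -expr2 sqrtCK div1r.
  rewrite -!big_split /= !big_seq; apply: eq_bigr => v c_v.
  by rewrite hermitian_randic_gain hermitian_randic_undirected (next_cycle adj_c) // invfM.
set D := (X in _ * X) => gD; apply: (mulIf _ (etrans gD (esym (mul1r D)))).
(* [D] can be cancelled: a vertex on the cycle has its successor as neighbour, so its degree is
   positive. *)
rewrite /D prodf_seq_neq0; apply/allP => v c_v /=.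
rewrite div1r invr_eq0 pnatr_eq0 -lt0n; apply/card_gt0P.
by exists (next c v); rewrite inE (next_cycle adj_c).
Qed.

Lemma char_poly_positive :
  char_poly (hermitian_randic C M)
    = char_poly (hermitian_randic C (undirected (underlying M))).
Proof.
have [s s_neq0 s_gain] := potential_exists (@adj_sym _ (underlying M))
  (@adj_irr _ (underlying M)) (fun u v _ => gain_inv u v) gain_cycle.
apply: (@char_poly_similar _ _ (diag_mx (\row_v s v))).
  by rewrite det_diag prodf_seq_neq0; apply/allP => v _; rewrite mxE s_neq0.
(* Entrywise, the claim is the potential relation times the Randić weight on edges, and 0 = 0
   elsewhere. *)
apply/matrixP => u v; rewrite mul_mx_diag mul_diag_mx mxE [RHS]mxE.
rewrite ![(\row_v s v) _ _]mxE hermitian_randic_gain hermitian_randic_undirected.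
case: ifP => [/s_gain-> | _]; last by rewrite !mulr0 mul0r.
by rewrite mulrAC.
Qed.

End Gain.

Theorem theorem2p4 (C : numClosedFieldType) (n : nat) (M : mixed_graph n) :
  positive_mixed_graph C M ->
  spectrum (hermitian_randic C M)
    = spectrum (hermitian_randic C (undirected (underlying M))).
Proof. by move=> M_pos; rewrite /spectrum (char_poly_positive M_pos). Qed.
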